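(* Let $\mathcal{I}$ be a proper admissible ideal on $\mathbb{N}$ and let $X$ be a Tychonoff space. If $\delta(X) = \omega$ and $\pi w(X) < \mathfrak{b}(\mathcal{I})$, then $X$ is $\mathcal{I}$-H-separable.
   Context: An ideal on $\mathbb{N}$ is a family of subsets of $\mathbb{N}$ closed under finite unions and under subsets; it is admissible if it contains every singleton and proper if it does not contain $\mathbb{N}$. A space $X$ is $\mathcal{I}$-H-separable if for every sequence $(Y_n)_{n\in\mathbb{N}}$ of dense subspaces of $X$ there is a sequence $(F_n)_{n\in\mathbb{N}}$ such that each $F_n$ is a finite subset of $Y_n$ and for every nonempty open set $U$ of $X$, $\{n\in\mathbb{N} : U\cap F_n=\emptyset\}\in\mathcal{I}$. $d(Y)$ is the minimal cardinality of a dense subspace of $Y$, and $\delta(X)=\sup\{d(Y): Y \text{ is dense in } X\}$. A $\pi$-base of $X$ is a collection $\mathcal{B}$ of open sets such that every nonempty open set contains a nonempty member of $\mathcal{B}$; $\pi w(X)$ is the least cardinality of a $\pi$-base of $X$. A set $S\subseteq\mathbb{N}^{\mathbb{N}}$ is $\mathcal{I}$-bounded if there is $g\in\mathbb{N}^{\mathbb{N}}$ such that $\{n\in\mathbb{N}: f(n)>g(n)\}\in\mathcal{I}$ for all $f\in S$, and $\mathcal{I}$-unbounded otherwise; $\mathfrak{b}(\mathcal{I})$ is the least cardinality of an $\mathcal{I}$-unbounded subset of $\mathbb{N}^{\mathbb{N}}$. *)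

(* Defs.v *)
From HB Require Import structures.
From mathcomp Require Import all_boot all_order all_algebra.
From mathcomp Require Import all_classical all_reals all_analysis.

Set Implicit Arguments.
Unset Strict Implicit.
Unset Printing Implicit Defensive.

Local Open Scope classical_set_scope.
Local Open Scope card_scope.

(* Cardinals are represented by sets, compared with [#<=] and [#=]. *)

Definition card_lt T U (A : set T) (B : set U) : bool :=
  (A #<= B) && ~~ (B #<= A).

Notation "A '#<' B" := (card_lt A B)
  (at level 79, format "A  '#<'  B") : card_scope.

(* A member of [P] of least cardinality: it represents the cardinal
   min {|A| : P A}.  The default value [set0] is only taken when [P] is empty,
   as [least_cardP] shows. *)
Definition least_card T (P : set (set T)) : set T :=
  xget set0 [set A | P A /\ forall B, P B -> A #<= B].

Lemma ex_least_card T (P : set (set T)) : P !=set0 ->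
  exists A, P A /\ forall B, P B -> A #<= B.
Proof.
move=> [A0 PA0].
pose good := [set S : set (set T -> T) |
  (forall g A, S g -> P A -> A (g A)) /\
  (forall g h A, S g -> S h -> P A -> g A = h A -> g = h)].
have [S [[Smem Sinj] Smax]] : exists S, good S /\ forall S', S `<` S' -> ~ good S'.
  apply: Zorn_bigcup => F Fgood Ftot; split.
    by move=> g A [S FS Sg] PA; have [Fm _] := Fgood _ FS; exact: Fm Sg PA.
  move=> g h A [S FS Sg] [S' FS' S'h] PA.
  have [SS'|S'S] := Ftot _ _ FS FS'.
    by have [_ Finj] := Fgood _ FS'; apply: Finj => //; exact: SS'.
  by have [_ Finj] := Fgood _ FS; apply: Finj => //; exact: S'S.
have [A PA Asurj] : exists2 A, P A & forall a, A a -> exists2 g, S g & g A = a.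
  apply: contrapT => noA.
  have choose_new A : exists a, P A -> A a /\ forall g, S g -> g A <> a.
    have new B : P B -> exists a, B a /\ forall g, S g -> g B <> a.
      move=> PB; apply: contrapT => nB; apply: noA; exists B => // a Ba.
      apply: contrapT => na; apply: nB; exists a; split => // g Sg gBa.
      by apply: na; exists g.
    have [PA|nPA] := pselect (P A); first by have [a ?] := new _ PA; exists a.
    by have [a _] := new _ PA0; exists a.
  have [g gP] := choice choose_new.
  apply: (Smax (S `|` [set g])).
    split; first by move=> h Sh; left.
    move=> /(_ g (or_intror erefl)) Sg.
    by have [_ gA0] := gP A0 PA0; exact: gA0 Sg erefl.
  split=> [h A [Sh|->] PA|h h' A [Sh|->] [Sh'|->] PA hh'] //.
  - exact: Smem Sh PA.
  - by have [] := gP A PA.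
  - exact: Sinj hh'.
  - by have [_ gA] := gP A PA; have := gA h Sh hh'.
  - by have [_ gA] := gP A PA; have := gA h' Sh' (esym hh').
exists A; split => // B PB.
have evalS C : P C -> [set g C | g in S] #= S.
  by move=> PC; apply: inj_card_eq => g h /set_mem Sg /set_mem Sh; exact: Sinj.
have AS : A `<=` [set g A | g in S] by move=> a /Asurj[g Sg <-]; exists g.
have SB : [set g B | g in S] `<=` B by move=> _ [g Sg <-]; exact: Smem Sg PB.
apply: card_le_trans (subset_card_le AS) _.
by rewrite (card_le_eql (evalS A PA)) -(card_le_eql (evalS B PB)) subset_card_le.
Qed.

Lemma least_cardP T (P : set (set T)) : P !=set0 ->
  P (least_card P) /\ forall B, P B -> least_card P #<= B.
Proof. by move=> /ex_least_card exA; exact: (xgetPex (P := [set A | P A /\ _]) set0 exA). Qed.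

Section ideals.
Variable I : set (set nat).

Definition nat_ideal :=
  [/\ I set0, (forall A B, I A -> I B -> I (A `|` B)) &
      (forall A B, A `<=` B -> I B -> I A)].

Definition admissible_nat_ideal := nat_ideal /\ forall n : nat, I [set n].

Definition proper_nat_ideal := nat_ideal /\ ~ I [set: nat].

Definition ideal_bounded (S : set (nat -> nat)) :=
  exists g : nat -> nat, forall f, S f -> I [set n | (g n < f n)%N].

Definition ideal_unbounded (S : set (nat -> nat)) := ~ ideal_bounded S.

Definition bounding_number : set (nat -> nat) := least_card ideal_unbounded.

End ideals.

Section spaces.
Variable X : topologicalType.

Definition tychonoff_space := hausdorff_space X /\ completely_regular_space X.

Definition density : set X := least_card (@dense X).

Definition pi_base (B : set (set X)) :=
  B `<=` open /\
  forall U, open U -> U !=set0 -> exists V, [/\ B V, V !=set0 & V `<=` U].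

Definition pi_weight : set (set X) := least_card pi_base.

Definition ideal_H_separable (I : set (set nat)) :=
  forall Y : nat -> set X, (forall n, dense (Y n)) ->
  exists F : nat -> set X,
    (forall n, finite_set (F n) /\ F n `<=` Y n) /\
    forall U, open U -> U !=set0 -> I [set n | U `&` F n = set0].

End spaces.

Arguments density : clear implicits.
Arguments pi_weight : clear implicits.

(* The supremum of the cardinals d(Y), for Y dense in X, as their least upper
   bound.  Here [set_type Y] carries the subspace topology.  It suffices to
   look for the least upper bound among cardinals of subsets of X, since X
   itself is an upper bound. *)
Definition dense_density_sup (X : topologicalType) : set X :=
  least_card [set K : set X |
    forall Y : set X, dense Y -> density (set_type Y) #<= K].

Arguments dense_density_sup : clear implicits.

(* Main.v *)
Require Import Defs.
From HB Require Import structures.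
From mathcomp Require Import all_boot all_order all_algebra.
From mathcomp Require Import all_classical all_reals all_analysis.
Local Open Scope classical_set_scope.
Local Open Scope card_scope.

(** Choose a countable dense subset [D n] of each [Y n], which exists because
[delta(X)] is countable, and label the points of [D n] injectively by natural
numbers.  A nonempty set [V] of a [pi]-base meets every [D n], so it determines
a function [f V] sending [n] to the label of some point of [V] in [D n].
A least [pi]-base yields a family of fewer than [b(I)] such functions, hence one
function [g] bounds them all modulo [I].  The points of [D n] with label at most
[g n] form the required finite set [F n]: if a nonempty open [U] misses [F n]
and [V] is a nonempty member of the [pi]-base inside [U], then
[g n < f V n], and the set of such [n] lies in [I].

Minimality of [bounding_number I] gives the bound ([ideal_bounded_card_lt]);
passing from [delta(X)] to actual countable dense sets is
[countable_dense_subset]. *)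

(** A family of functions that was not bounded would compete in the minimum
that defines the bounding number. *)
Lemma ideal_bounded_card_lt (I : set (set nat)) T (A : set T)
    (S : set (nat -> nat)) :
  S #<= A -> A #< bounding_number I -> ideal_bounded I S.
Proof.
move=> SA /andP[_ /negP bA]; apply: contrapT => S_unbounded; apply: bA.
have [_ least] := @least_cardP _ (ideal_unbounded I) (ex_intro _ S S_unbounded).
exact: card_le_trans (least _ S_unbounded) SA.
Qed.

Lemma dense_density (X : topologicalType) : dense (density X).
Proof.
apply: (@least_cardP _ (@dense X) _).1.
by exists setT => O O0 _; rewrite setIT.
Qed.

Lemma pi_base_pi_weight (X : topologicalType) : pi_base (pi_weight X).
Proof.
apply: (@least_cardP _ (@pi_base X) _).1.
by exists open; split=> // U oU U0; exists U; split.
Qed.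

(** The least upper bound is a genuine one: all of [X] is an upper bound, since
[density (set_type Y)] embeds into [X], so the minimum is over a nonempty
family. *)
Lemma density_le_sup (X : topologicalType) (Y : set X) :
  dense Y -> density (set_type Y) #<= dense_density_sup X.
Proof.
apply: (@least_cardP _ [set K : set X |
  forall Y : set X, dense Y -> density (set_type Y) #<= K] _).1.
exists setT => Z _.
have inj_val : {in density Z &, injective (set_val : Z -> X)}.
  by move=> x y _ _; exact: val_inj.
by rewrite -(card_le_eql (inj_card_eq inj_val)) subset_card_le.
Qed.

(** Density is transitive: a dense subset of the subspace [Y] is dense in [X]
because the trace on [Y] of a nonempty open set is open and nonempty. *)
Lemma dense_image_set_val (X : topologicalType) (Y : set X)
    (D : set (set_type Y)) :
  dense Y -> dense D -> dense [set set_val y | y in D].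
Proof.
move=> dY dD O O0 oO; have [x [Ox Yx]] := dY O O0 oO.
have [] := dD (set_val @^-1` O).
- by exists (SigSub (mem_set Yx)).
- by exists O.
- by move=> y [Oy Dy]; exists (set_val y); split=> //; exists y.
Qed.

Lemma countable_dense_subset (X : topologicalType) (Y : set X) :
  countable (dense_density_sup X) -> dense Y ->
  exists D : set X, [/\ countable D, D `<=` Y & dense D].
Proof.
move=> sup_countable dY.
exists [set set_val y | y in density (set_type Y)]; split.
- apply: card_le_trans (card_image_le _ _) _.
  exact: card_le_trans (density_le_sup _ _ dY) sup_countable.
- by move=> _ [y _ <-]; exact: set_valP.
- exact: dense_image_set_val dY (@dense_density _).
Qed.

Lemma finite_set_bounded_label T (D : set T) (c : T -> nat) (m : nat) :
  {in D &, injective c} -> finite_set [set x | D x /\ (c x <= m)%N].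
Proof.
move=> c_inj; set F := [set x | _].
have c_injF : {in F &, injective c}.
  by move=> x y /set_mem[Dx _] /set_mem[Dy _]; apply: c_inj; exact: mem_set.
rewrite -(eq_finite_set (inj_card_eq c_injF)).
apply: sub_finite_set (finite_II m.+1) => _ [x [_ cxm] <-] /=.
by rewrite ltnS.
Qed.

Theorem theorem3p18 (I : set (set nat)) (X : topologicalType)
    (I_proper : proper_nat_ideal I) (I_admissible : admissible_nat_ideal I)
    (X_tychonoff : tychonoff_space X)
    (delta_omega : dense_density_sup X #= [set: nat])
    (piw_lt_b : pi_weight X #< bounding_number I) :
  ideal_H_separable X I.
Proof.
move=> Y dY.
have sup_countable : countable (dense_density_sup X).
  by rewrite /countable (card_le_eql delta_omega).
have /choice[D DP] n := countable_dense_subset X (Y n) sup_countable (dY n).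
have /choice[c c_inj] n : exists c : X -> nat, {in D n &, injective c}.
  by have [/countable_injP[c /= cP] _ _] := DP n; exists c.
have [pi_open pi_sub] := pi_base_pi_weight X.
(* The labelling function is built for every set, with a default value off the
   nonempty open ones, so that the image of the whole pi-base under f has at
   most the cardinality of the pi-base. *)
have /choice[f fP] (V : set X) : exists h : nat -> nat,
    open V -> V !=set0 -> forall n, exists x, [/\ V x, D n x & c n x = h n].
  have [[oV V0]|nV] := pselect (open V /\ V !=set0); last first.
    by exists (fun=> 0%N) => oV V0; case: nV.
  have /choice[p pP] n : exists x, V x /\ D n x.
    by have [_ _ dD] := DP n; exact: dD V0 oV.
  by exists (fun n => c n (p n)) => _ _ n; exists (p n); have [] := pP n.
have [g gP] := ideal_bounded_card_lt I _ _ _ (card_image_le f _) piw_lt_b.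
exists (fun n => [set x | D n x /\ (c n x <= g n)%N]); split.
  move=> n; split; first exact: finite_set_bounded_label (c_inj n).
  by have [_ DY _] := DP n; move=> x [/DY].
move=> U oU U0; have [V [BV V0 VU]] := pi_sub U oU U0.
have [[_ _ I_sub] _] := I_proper.
apply: I_sub (gP (f V) _); last by exists V.
move=> n /= UF0; rewrite ltnNge; apply/negP => fg.
have [x [Vx Dx cx]] := fP V (pi_open _ BV) V0 n.
have : (U `&` [set x | D n x /\ (c n x <= g n)%N]) x.
  by split; [exact: VU | split; rewrite ?cx].
by rewrite UF0.
Qed.
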